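(* Let $G\in\mathcal{G}$ and let $\ell_G$ be its Lévy-induced level function. Consider the following data structure, working in the random oracle model with a uniformly random hash function $H:[n]\to[0,1]$ (the values $H(v)$, $v\in[n]$, i.i.d. $\mathrm{Uniform}(0,1)$). Its only state is a pair $(v_*,h_* )\in([n]\cup\{\perp\})\times(\mathbb{R}_+\cup\{\infty\})$, initially $(\perp,\infty)$. A vector $\mathbf{x}\in\mathbb{R}_+^n$ is initially $0$ and undergoes a stream of updates $\textsf{Update}(v,\Delta)$ with $v\in[n]$, $\Delta>0$, meaning $\mathbf{x}(v)\gets\mathbf{x}(v)+\Delta$. On each update, the data structure draws a fresh $Y\sim\mathrm{Exp}(1)$ independent of everything else, computes $h=\ell_G(Y/\Delta,H(v))$, and if $h<h_*$ sets $(v_*,h_* )\gets(v,h)$. Then at all times, for every $v\in[n]$, \[ \mathbb{P}(v_*=v)=\frac{G(\mathbf{x}(v))}{G(\mathbf{x})},\qquad\text{where } G(\mathbf{x})=\sum_{u\in[n]}G(\mathbf{x}(u)), \] i.e., it is a truly perfect $G$-sampler with zero probability of failure, storing only the pair $(v_*,h_* )$.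
   Context: $\mathbb{R}_+$ is the set of non-negative reals; $\mathrm{Exp}(\lambda)$ is the exponential distribution with rate $\lambda$. The class $\mathcal{G}$ consists of all functions $G:\mathbb{R}_+\to\mathbb{R}_+$ of the form $G(z)=c\,\mathbf{1}[z>0]+\gamma_0 z+\int_{(0,\infty)}(1-e^{-rz})\,\nu(dr)$ with $c,\gamma_0\ge0$ and $\nu$ a non-negative measure on $(0,\infty)$ satisfying $\int_{(0,\infty)}\min\{r,1\}\nu(dr)<\infty$. By the Lévy–Khintchine representation, each $G\in\mathcal{G}$ corresponds to a non-negative (possibly killed, i.e. allowed to take the value $\infty$) Lévy process $(X_t)_{t\ge0}$ (stationary independent increments, $X_0=0$, stochastically continuous) with $\mathbb{E}e^{-zX_t}=e^{-tG(z)}$ for all $t,z\ge0$. The Lévy-induced level function $\ell_G:(0,\infty)\times(0,1)\to\mathbb{R}_+$ is $\ell_G(a,b)=\inf\{t\ge 0:\mathbb{P}(X_t\ge a)\ge b\}$. *)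

(* Defs.v *)
From HB Require Import structures.
From mathcomp Require Import all_boot all_order all_algebra.
From mathcomp Require Import all_classical all_reals all_analysis measurable_realfun.
Set Implicit Arguments. Unset Strict Implicit. Unset Printing Implicit Defensive.
Import Order.TTheory GRing.Theory Num.Theory.
Import numFieldNormedType.Exports.
Local Open Scope classical_set_scope.
Local Open Scope ring_scope.

Section Defs.
Variable R : realType.

(* The class \mathcal{G}:
   G(z) = c 1[z>0] + g0 z + \int_{(0,oo)} (1 - e^{-rz}) nu(dr), z >= 0,
   with c, g0 >= 0 and nu a measure on (0,oo) with \int min(r,1) dnu < oo.
   (nu is a Borel measure on R; only its restriction to (0,oo) is used.) *)
Definition in_class_G (G : R -> R) : Prop :=
  exists (c g0 : R) (nu : {measure set R -> \bar R}),
    [/\ 0 <= c, 0 <= g0,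
     (\int[nu]_(r in `]0%R, +oo[) (Num.min r 1)%:E < +oo)%E &
     forall z, 0 <= z ->
       (G z)%:E = (((if (0 < z)%R then c else 0) + g0 * z)%:E
                   + \int[nu]_(r in `]0%R, +oo[) (1 - expR (- (r * z)))%:E)%E].

(* e^{-z x} for x in [0, +oo], with the convention 0 * oo = 0. *)
Definition laplace_kernel (z : R) (x : \bar R) : R :=
  match x with
  | EFin r => expR (- (z * r))
  | EPInf => if z == 0 then 1 else 0
  | ENInf => 0
  end.

(* X is a (possibly killed) non-negative process with
   E e^{-z X_t} = e^{-t G(z)} for all t, z >= 0 *)
Definition levy_process_of (G : R -> R) (d : measure_display) (W : measurableType d)
    (PX : probability W R) (X : R -> W -> \bar R) : Prop :=
  [/\ forall t w, (0 <= X t w)%E,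
      forall t, measurable_fun [set: W] (X t) &
      forall t z, 0 <= t -> 0 <= z ->
        (\int[PX]_w (laplace_kernel z (X t w))%:E = (expR (- (t * G z)))%:E)%E].

(* Levy-induced level function l(a,b) = inf { t >= 0 : P(X_t >= a) >= b }
   (inf of the empty set is +oo). *)
Definition levy_level (d : measure_display) (W : measurableType d)
    (PX : probability W R) (X : R -> W -> \bar R) (a b : R) : \bar R :=
  ereal_inf [set t%:E | t in [set t : R | 0 <= t /\
                                 (b%:E <= PX [set w | (a%:E <= X t w)%E])%E]].

Definition uniform01_rv (d : measure_display) (W : measurableType d)
    (P : probability W R) (U : W -> R) : Prop :=
  measurable_fun setT U /\
  forall B : set R, measurable B ->
    P (U @^-1` B) = lebesgue_measure (B `&` `[0%R, 1%R]).

Definition exp1_rv (d : measure_display) (W : measurableType d)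
    (P : probability W R) (Y : W -> R) : Prop :=
  measurable_fun setT Y /\
  forall B : set R, measurable B ->
    P (Y @^-1` B) =
      (\int[lebesgue_measure]_(y in B `&` `[0%R, +oo[) (expR (- y))%:E)%E.

Definition mutually_independent (d : measure_display) (W : measurableType d)
    (P : probability W R) (I : finType) (Z : I -> W -> R) : Prop :=
  forall B : I -> set R, (forall j, measurable (B j)) ->
    P (\bigcap_(j in setT) (Z j @^-1` B j)) = (\prod_(j : I) P (Z j @^-1` B j))%E.

Definition ds_step (n : nat) (st : option 'I_n * \bar R) (vh : 'I_n * \bar R)
  : option 'I_n * \bar R :=
  if (vh.2 < st.2)%E then (Some vh.1, vh.2) else st.

Definition ds_run (n : nat) (s : seq ('I_n * \bar R)) : option 'I_n * \bar R :=
  foldl (@ds_step n) (None, +oo%E) s.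

End Defs.

(* Main.v *)
Require Import Defs.
From HB Require Import structures.
From mathcomp Require Import all_boot all_order all_algebra.
From mathcomp Require Import all_classical all_reals all_analysis measurable_realfun.
From mathcomp Require Import ring lra.
Set Implicit Arguments. Unset Strict Implicit. Unset Printing Implicit Defensive.
Import Order.TTheory GRing.Theory Num.Theory.
Import numFieldNormedType.Exports.
Local Open Scope classical_set_scope.
Local Open Scope ring_scope.

(** Let h_u be the least hash l(Y_i / Delta_i, H u) over the updates i of u. Once
    t |-> P(X_t >= a) is known to be nondecreasing, {h_u > t} is, up to a null set,
    the event {H u > max_i P(X_t >= Y_i / Delta_i)}. Conditioning on the Y_i and
    exchanging the two integrations turns its probability into
    E exp(- x(u) X_t) = exp(- t G(x(u))), and these events are independent over u: the
    h_u are independent exponentials of rates G(x(u)).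

    Only Laplace transforms are available, so monotonicity in t comes from the moments
    of exp(- z X_t) with exp(- z a) = 1/2: they are products of those at s and at
    t - s, and decreasing polynomials converging to the indicator of [0, 1/2] compare
    the two tails.

    For the minimum, only the lower bound P(v_* = u) >= G(x(u)) / G(x) is computed, by
    a time grid of vanishing mesh; the bounds sum to 1 and the events are disjoint, so
    all of them are equalities and ties need no separate treatment. *)

(** * Polynomials approximating the indicator of [0, 1/2] *)

Lemma bernoulli_ineq (R : realDomainType) (x : R) n : -1 <= x -> 1 + x *+ n <= (1 + x) ^+ n.
Proof.
move=> x1; elim: n => [|n IH]; first by rewrite mulr0n addr0 expr0.
have h : 0 <= 1 + x by rewrite -lerBlDl sub0r.
rewrite exprS; apply: (le_trans _ (ler_wpM2l h IH)).
rewrite -subr_ge0 (_ : _ - _ = x ^+ 2 *+ n); first by rewrite mulrn_wge0// sqr_ge0.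
by rewrite mulrSr -[x *+ n]mulr_natl -[x ^+ 2 *+ n]mulr_natl; ring.
Qed.

(* With [c = 2^(n^2)] and [y = p^(n^2+n)], the bounds
   [1 - c y <= (1 - y)^c <= 1 / (1 + c y)] give convergence to the indicator of [p <= 1/2],
   the value at [p = 1/2] included since there [c y = 2^-n]. *)
Definition halfstep {R : realType} (n : nat) : {poly R} :=
  (1 - 'X ^+ (n ^ 2 + n)) ^+ (2 ^ (n ^ 2)).

Lemma horner_halfstep (R : realType) n (p : R) :
  (halfstep n : {poly R}).[p] = (1 - p ^+ (n ^ 2 + n)) ^+ (2 ^ (n ^ 2)).
Proof. by rewrite /halfstep horner_exp !hornerE. Qed.

Lemma halfstep_itv (R : realType) n (p : R) : 0 <= p <= 1 ->
  0 <= (halfstep n : {poly R}).[p] <= 1.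
Proof.
move=> /andP[p0 p1]; rewrite horner_halfstep.
have h1 : p ^+ (n ^ 2 + n) <= 1 by rewrite exprn_ile1.
have h0 : 0 <= p ^+ (n ^ 2 + n) by rewrite exprn_ge0.
by rewrite exprn_ge0 ?subr_ge0//= exprn_ile1// ?subr_ge0// lerBlDr lerDl.
Qed.

Lemma halfstep_anti (R : realType) n (p q : R) : 0 <= p -> p <= q -> q <= 1 ->
  (halfstep n : {poly R}).[q] <= (halfstep n).[p].
Proof.
move=> p0 pq q1; rewrite !horner_halfstep.
have q0 := le_trans p0 pq.
apply: lerXn2r; rewrite ?nnegrE ?subr_ge0 ?exprn_ile1// ?(le_trans pq)//.
by rewrite lerB// lerXn2r// nnegrE.
Qed.

Lemma halfstep_ge (R : realType) n (p : R) : 0 <= p <= 2^-1 ->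
  1 - 2^-1 ^+ n <= (halfstep n : {poly R}).[p].
Proof.
move=> /andP[p0 p1]; rewrite horner_halfstep.
set y := p ^+ _; have y0 : 0 <= y by rewrite exprn_ge0.
have y1 : y <= 2^-1 ^+ (n ^ 2 + n) by rewrite lerXn2r// nnegrE.
have y2 : y <= 1 by rewrite exprn_ile1// (le_trans p1)//; lra.
have := @bernoulli_ineq _ (- y) (2 ^ (n ^ 2)); rewrite lerN2 => /(_ y2).
apply: le_trans; rewrite mulNrn lerB// -[y *+ _]mulr_natl natrX.
apply: (le_trans (ler_wpM2l _ y1)); first by rewrite exprn_ge0.
by rewrite exprD mulrA -exprMn divff ?expr1n ?mul1r.
Qed.

(** Here [c y = ((2 p)^n p)^n], so the second hypothesis yields [c y >= 2^n], and then
    [1 / (1 + c y) <= 2^-n]. *)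
Lemma halfstep_le (R : realType) n (p : R) : 0 <= p <= 1 ->
  2 <= (2 * p) ^+ n * p -> (halfstep n : {poly R}).[p] <= 2^-1 ^+ n.
Proof.
move=> /andP[p0 p1] h; rewrite horner_halfstep.
set y := p ^+ _; have y0 : 0 <= y by rewrite exprn_ge0.
have y2 : y <= 1 by rewrite exprn_ile1.
have b : (2 ^+ n : R) <= (1 + y) ^+ (2 ^ n ^ 2).
  have := @bernoulli_ineq _ y (2 ^ (n ^ 2)) (le_trans (lerN10 _) y0).
  apply: le_trans; rewrite -[y *+ _]mulr_natl natrX.
  apply: (@le_trans _ _ (((2 * p) ^+ n * p) ^+ n)).
    by rewrite lerXn2r// nnegrE// (le_trans _ h).
  rewrite exprMn -exprM mulnn exprMn -mulrA -exprD -/y.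
  by rewrite lerDr.
(* [(1 - y) (1 + y) <= 1] raised to the power [c = 2^(n^2)]: an upper bound on [(1 - y)^c] without
   division. *)
have c : (1 - y) ^+ (2 ^ n ^ 2) * (1 + y) ^+ (2 ^ n ^ 2) <= 1.
  rewrite -exprMn exprn_ile1//.
    by rewrite mulr_ge0// ?subr_ge0// addr_ge0.
  by rewrite -subr_sqr expr1n lerBlDr lerDl sqr_ge0.
have d : (1 - y) ^+ (2 ^ n ^ 2) * 2 ^+ n <= 1.
  apply: le_trans c; rewrite ler_wpM2l// exprn_ge0// subr_ge0//.
by rewrite exprVn -[leRHS]mul1r ler_pdivlMr// exprn_gt0.
Qed.

Lemma cvg_half_expr (R : realType) : (2^-1 ^+ n : R) @[n --> \oo] --> (0 : R).
Proof. by apply: cvg_expr; rewrite ger0_norm; lra. Qed.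

Lemma cvg_halfstep (R : realType) (p : R) : 0 <= p <= 1 ->
  (halfstep n : {poly R}).[p] @[n --> \oo] --> (if p <= 2^-1 then 1 else 0 : R).
Proof.
move=> p01; have /andP[p0 p1] := p01; case: ifPn => [ph|].
  apply: (@squeeze_cvgr _ _ _ _ (fun n => 1 - 2^-1 ^+ n) (fun=> 1)).
  - apply: nearW => n; rewrite halfstep_ge ?p0//=.
    by have /andP[] := halfstep_itv n p01.
  - rewrite -[X in _ --> X]subr0; apply: cvgB; [exact: cvg_cst|exact: cvg_half_expr].
  - exact: cvg_cst.
rewrite -ltNge => ph.
apply: (@squeeze_cvgr _ _ _ _ (fun=> 0) (fun n => 2^-1 ^+ n)); last 2 first.
- exact: cvg_cst.
- exact: cvg_half_expr.
have pp : 0 < p by lra.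
have x0 : 0 < 2 * p - 1 by lra.
near=> n; have /andP[-> _] := halfstep_itv n p01 => /=.
apply: halfstep_le => //.
(* Bernoulli gives [(2 p)^n >= 1 + n (2 p - 1)], which exceeds [2 / p] for large [n] because
   [p > 1/2]. *)
rewrite -ler_pdivrMr//.
have -> : 2 * p = 1 + (2 * p - 1) by ring.
apply: le_trans (bernoulli_ineq _ _) => //; last by lra.
rewrite -[_ *+ n]mulr_natl -lerBlDl -ler_pdivrMr//.
near: n; exact: nbhs_infty_ger.
Unshelve. all: by end_near. Qed.

(** * Monotonicity in time of the tails of the process *)

Lemma integrable_bounded01 (R : realType) d (T : measurableType d) (P : probability T R)
    (f : T -> R) :
  measurable_fun setT f -> (forall w, 0 <= f w <= 1) -> P.-integrable setT (EFin \o f).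
Proof.
move=> mf f01; apply: measurable_bounded_integrable => //.
  by rewrite ltey_eq fin_num_measure.
exists 1; split; rewrite ?num_real// => x x1 w _ /=.
by have /andP[f0 f1] := f01 w; rewrite ger0_norm// (le_trans f1)// ltW.
Qed.

Lemma integral_moments (R : realType) d (T : measurableType d) (P : probability T R)
    (p : T -> R) (m c : nat -> R) n :
  measurable_fun setT p -> (forall w, 0 <= p w <= 1) ->
  (forall j, \int[P]_w (p w ^+ j)%:E = (m j)%:E)%E ->
  (\int[P]_w (\sum_(j < n) c j * p w ^+ j)%:E)%E = (\sum_(j < n) c j * m j)%:E.
Proof.
move=> mp p01 hm.
have ip j : P.-integrable setT (fun w => (p w ^+ j)%:E).
  apply: integrable_bounded01; first exact: measurable_funX.
  by move=> w; have /andP[p0 p1] := p01 w; rewrite exprn_ge0//= exprn_ile1.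
under eq_integral do rewrite -sumEFin.
rewrite integral_sum//; last first.
  by move=> j; under eq_fun do rewrite EFinM; exact: integrableZl.
rewrite -sumEFin; apply: eq_bigr => j _.
by under eq_integral do rewrite EFinM; rewrite integralZl// hm.
Qed.

(* If [p''] has the law of a product of independent copies of [p] and [p'], all in
   [0, 1], then [E q(p) <= E q(p'')] for decreasing [q]. The independent product is not
   needed: [y |-> E q(p y)] is a polynomial with coefficients [q_j E p^j]. *)
Lemma integral_anti_product_moments (R : realType) d (T : measurableType d)
    (P : probability T R) (p p' p'' : T -> R) (a b : nat -> R) (q : {poly R}) :
  measurable_fun setT p -> (forall w, 0 <= p w <= 1) ->
  measurable_fun setT p' -> (forall w, 0 <= p' w <= 1) ->
  measurable_fun setT p'' -> (forall w, 0 <= p'' w <= 1) ->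
  (forall j, \int[P]_w (p w ^+ j)%:E = (a j)%:E)%E ->
  (forall j, \int[P]_w (p' w ^+ j)%:E = (b j)%:E)%E ->
  (forall j, \int[P]_w (p'' w ^+ j)%:E = (a j * b j)%:E)%E ->
  (forall x : R, 0 <= x <= 1 -> 0 <= q.[x] <= 1) ->
  (forall x y : R, 0 <= x -> x <= y -> y <= 1 -> q.[y] <= q.[x]) ->
  (\int[P]_w (q.[p w])%:E <= \int[P]_w (q.[p'' w])%:E)%E.
Proof.
move=> mp p01 mp' p'01 mp'' p''01 ha hb hab q01 qanti.
have intq (f : T -> R) (m : nat -> R) : measurable_fun setT f -> (forall w, 0 <= f w <= 1) ->
    (forall j, \int[P]_w (f w ^+ j)%:E = (m j)%:E)%E ->
    (\int[P]_w (q.[f w])%:E)%E = (\sum_(j < size q) q`_j * m j)%:E.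
  move=> mf f01 hm; under eq_integral do rewrite horner_coef.
  exact: integral_moments.
rewrite (intq _ a)// (intq _ (fun j => a j * b j))//.
(* The sum of the [q_j a_j b_j] is read as the expectation over [p'] of a polynomial with
   coefficients [q_j a_j], and the left side as the integral of a constant. *)
under [in leRHS]eq_bigr do rewrite mulrA.
rewrite -(integral_moments (fun j => q`_j * a j) (size q) mp' p'01 hb).
rewrite -[leLHS]mule1 -(probability_setT P) -integral_cst//.
(* With [y = p' w] frozen, this compares [E q(p)] with [E q(p y)]: [p y <= p] and [q] decreases. *)
have cle w : \sum_(j < size q) q`_j * a j <= \sum_(j < size q) q`_j * a j * p' w ^+ j.
  have /andP[y0 y1] := p'01 w.
  have py01 w' : 0 <= p w' * p' w <= 1.
    by have /andP[x0 x1] := p01 w'; rewrite mulr_ge0//= mulr_ile1.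
  have mq (f : T -> R) : measurable_fun setT f -> measurable_fun setT (fun w => (q.[f w])%:E).
    move=> mf; apply/measurable_EFinP; under eq_fun do rewrite horner_coef.
    by apply: measurable_sum => j; apply: measurable_funM => //; exact: measurable_funX.
  have mpy : measurable_fun setT (fun w' => p w' * p' w) by exact: measurable_funM.
  rewrite -lee_fin -(intq p a)//; under eq_bigr do rewrite -mulrA.
  rewrite -(intq (fun w' => p w' * p' w) (fun j => a j * p' w ^+ j))//; last first.
    move=> j; under eq_integral do rewrite exprMn mulrC EFinM.
    rewrite integralZl// ?ha -?EFinM 1?mulrC//.
    apply: integrable_bounded01; first exact: measurable_funX.
    by move=> w'; have /andP[x0 x1] := p01 w'; rewrite exprn_ge0//= exprn_ile1.
  apply: ge0_le_integral => //.
  - by move=> w' _; rewrite lee_fin; have /andP[] := q01 _ (p01 w').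
  - exact: mq.
  - exact: mq.
  - move=> w' _; rewrite lee_fin; have /andP[x0 x1] := p01 w'.
    by apply: qanti => //; [rewrite mulr_ge0|rewrite ler_piMr].
apply: le_integral => //.
- exact: finite_measure_integrable_cst.
- under eq_fun do rewrite -sumEFin.
  apply: integrable_sum => // j _; under eq_fun do rewrite EFinM; apply: integrableZl => //.
  apply: integrable_bounded01; first exact: measurable_funX.
  by move=> w; have /andP[x0 x1] := p'01 w; rewrite exprn_ge0//= exprn_ile1.
- by move=> w _; rewrite lee_fin.
Qed.

Lemma cvg_integral_halfstep (R : realType) d (T : measurableType d)
    (P : probability T R) (p : T -> R) :
  measurable_fun setT p -> (forall w, 0 <= p w <= 1) ->
  (\int[P]_w (((halfstep n : {poly R}).[p w])%:E) @[n --> \oo] -->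
   P [set w | (p w <= 2^-1)%R])%E.
Proof.
move=> mp p01.
pose A := [set w | (p w <= 2^-1)%R].
have mA : measurable A.
  rewrite -[A]setTI; have -> : A = p @^-1` `]-oo, 2^-1] by apply/seteqP; split=> w /=; rewrite in_itv.
  exact: mp.
have -> : P A = (\int[P]_w (\1_A w)%:E)%E by rewrite integral_indic// setIT.
have mq n : measurable_fun setT (fun w => ((halfstep n : {poly R}).[p w])%:E).
  apply/measurable_EFinP; under eq_fun do rewrite horner_coef.
  by apply: measurable_sum => j; apply: measurable_funM => //; exact: measurable_funX.
have [] := @dominated_convergence _ T R P setT measurableT
  (fun n w => ((halfstep n : {poly R}).[p w])%:E) (fun w => (\1_A w)%:E) (cst 1%E) mq => //.
- exact/measurable_EFinP/measurable_indic.
- apply: aeW => w _; apply: cvg_EFin; first exact: nearW.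
  have := cvg_halfstep (p01 w).
  rewrite indicE; case: ifPn => h; first by rewrite mem_set.
  by rewrite memNset//; exact/negP.
- exact: finite_measure_integrable_cst.
- apply: aeW => w n _ /=; rewrite lee_fin.
  by have /andP[h0 h1] := halfstep_itv n (p01 w); rewrite ger0_norm.
Qed.

(** The comparison for each [halfstep n] passes to the limit. As the limit at 1/2 is 1, an atom
    there is counted on both sides. *)
Lemma prob_le_half_product_moments (R : realType) d (T : measurableType d)
    (P : probability T R) (p p' p'' : T -> R) (a b : nat -> R) :
  measurable_fun setT p -> (forall w, 0 <= p w <= 1) ->
  measurable_fun setT p' -> (forall w, 0 <= p' w <= 1) ->
  measurable_fun setT p'' -> (forall w, 0 <= p'' w <= 1) ->
  (forall j, \int[P]_w (p w ^+ j)%:E = (a j)%:E)%E ->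
  (forall j, \int[P]_w (p' w ^+ j)%:E = (b j)%:E)%E ->
  (forall j, \int[P]_w (p'' w ^+ j)%:E = (a j * b j)%:E)%E ->
  (P [set w | (p w <= 2^-1)%R] <= P [set w | (p'' w <= 2^-1)%R])%E.
Proof.
move=> mp p01 mp' p'01 mp'' p''01 ha hb hab.
have c1 := cvg_integral_halfstep (P := P) mp p01.
have c2 := cvg_integral_halfstep (P := P) mp'' p''01.
rewrite -(cvg_lim _ c1)// -(cvg_lim _ c2)//; apply: lee_lim.
- by apply/cvg_ex; eexists; exact: c1.
- by apply/cvg_ex; eexists; exact: c2.
apply: nearW => n; apply: integral_anti_product_moments ha hb hab _ _ => //.
- by move=> x x01; exact: halfstep_itv.
- by move=> x y; exact: halfstep_anti.
Qed.

Section levy_tail.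
Context (R : realType) (G : R -> R) (d : measure_display) (W : measurableType d).
Context (PX : probability W R) (X : R -> W -> \bar R).
Hypothesis hX : levy_process_of G PX X.

Lemma laplace_kernel_itv (z : R) x : 0 <= z -> (0 <= x)%E -> 0 <= laplace_kernel z x <= 1.
Proof.
case: x => [x||]//= z0 x0; last by case: ifP; rewrite ?lexx ?ler01.
by rewrite expR_ge0 expR_le1 oppr_le0 mulr_ge0.
Qed.

(** Turns the moments of [exp (- z X_t)] into Laplace transforms at multiples of [z]. At [x = +oo]
    and [j = 0] both sides are 1, by the convention [0 * oo = 0]. *)
Lemma laplace_kernelX (z : R) x j : 0 < z -> (0 <= x)%E ->
  laplace_kernel z x ^+ j = laplace_kernel (j%:R * z) x.
Proof.
case: x => [x||]//= z0 x0.
  by rewrite -expRM_natl mulrN mulrA.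
by rewrite gt_eqF// mulf_eq0 (gt_eqF z0) orbF pnatr_eq0 expr0n; case: (j == 0)%N.
Qed.

Lemma measurable_laplace_kernel z t :
  measurable_fun setT (fun w => laplace_kernel z (X t w)).
Proof.
case: hX => X0 mX _.
have -> : (fun w => laplace_kernel z (X t w)) =
   (fun w => if (X t w == +oo)%E then laplace_kernel z +oo%E else expR (- (z * fine (X t w)))).
  apply/funext => w; have := X0 t w; case: (X t w) => //.
apply: measurable_fun_ifT => //.
- apply: (measurable_fun_bool true); rewrite setTI.
  have -> : (fun w => (X t w == +oo)%E) @^-1` [set true] = setT `&` X t @^-1` [set +oo%E].
    by rewrite setTI; apply/seteqP; split=> w /= /eqP.
  exact: mX.
- apply: measurableT_comp => //; apply: measurableT_comp => //.
  by apply: measurable_funM => //; apply: measurableT_comp => //; exact: mX.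
Qed.

Lemma laplace_exponent0 : G 0 = 0.
Proof.
case: hX => X0 _ /(_ 1 0 ler01 (lexx 0)).
have -> : (fun w => (laplace_kernel 0 (X 1 w))%:E) = cst 1%E.
  by apply/funext => w; have := X0 1 w; case: (X 1 w) => [x||]//=; rewrite ?mul0r ?oppr0 ?expR0 ?eqxx.
rewrite integral_cst// [X in (_ * X)%E](probability_setT PX) mule1 mul1r => -[] /eqP.
by rewrite -expR0 (inj_eq (@expR_inj _)) -eqr_oppLR oppr0 => /eqP.
Qed.

(** Read off from the process: [exp (- G z)] is the expectation, at time 1, of a kernel bounded by
    1. *)
Lemma laplace_exponent_ge0 z : 0 <= z -> 0 <= G z.
Proof.
move=> z0; case: hX => X0 _ /(_ 1 z ler01 z0) h.
rewrite -oppr_le0 -expR_le1 -lee_fin -[G z]mul1r -h.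
have <- : (\int[PX]_w (cst 1%E w) = 1)%E.
  by rewrite integral_cst// [X in (_ * X)%E](probability_setT PX) mule1.
apply: ge0_le_integral => //.
- by move=> w _; rewrite lee_fin; case/andP: (laplace_kernel_itv z0 (X0 1 w)).
- exact/measurable_EFinP/measurable_laplace_kernel.
- by move=> w _; rewrite lee_fin; case/andP: (laplace_kernel_itv z0 (X0 1 w)).
Qed.

Lemma tail_measurable t a : measurable [set w | (a%:E <= X t w)%E].
Proof.
by case: hX => _ mX _; rewrite -[X in measurable X]setTI; apply: emeasurable_fun_c_infty.
Qed.

Lemma tail_homo_time s t a : 0 <= s -> s <= t ->
  (PX [set w | (a%:E <= X s w)%E] <= PX [set w | (a%:E <= X t w)%E])%E.
Proof.
move=> s0 st; case: (hX) => X0 mX hL.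
have t0 := le_trans s0 st.
have [a0|a0] := leP a 0.
  have h u : [set w | (a%:E <= X u w)%E] = setT.
    by apply/seteqP; split=> w //= _; apply: le_trans (X0 u w); rewrite lee_fin.
  by rewrite !h.
(* This [z] gives [exp (- z a) = 1/2], so [X_u >= a] becomes a bound by 1/2 on the kernel; a killed
   path has kernel 0 and satisfies both. *)
pose z : R := ln 2 / a.
have l2 : 0 < ln 2 :> R by rewrite ln_gt0; lra.
have z0 : 0 < z by rewrite divr_gt0.
have h u : [set w | (a%:E <= X u w)%E] = [set w | (laplace_kernel z (X u w) <= 2^-1)%R].
  apply/seteqP; split=> w /=; have := X0 u w; case: (X u w) => [x||]//= _.
  - rewrite lee_fin => ax; rewrite -[2^-1](@lnK R) ?posrE ?invr_gt0// ler_expR.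
    by rewrite lnV ?posrE// lerN2 /z -mulrA ler_peMr ?(ltW l2)// mulrC ler_pdivlMr// mul1r.
  - by move=> _; rewrite gt_eqF// invr_ge0.
  - rewrite lee_fin -[2^-1](@lnK R) ?posrE ?invr_gt0// ler_expR lnV ?posrE// lerN2.
    by rewrite /z -mulrA -ler_pdivrMl// mulVf ?gt_eqF// mulrC ler_pdivlMr// mul1r.
  - by rewrite leey.
have mom u j : 0 <= u ->
    (\int[PX]_w (laplace_kernel z (X u w) ^+ j)%:E = (expR (- (u * G (j%:R * z))))%:E)%E.
  move=> u0; under eq_integral do rewrite laplace_kernelX//.
  by rewrite hL// mulr_ge0// ltW.
rewrite !h.
(* The process at time [t - s] stands in for an independent increment: only its moments enter, and
   [exp (- s g) exp (- (t - s) g) = exp (- t g)]. *)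
apply: (@prob_le_half_product_moments _ _ _ _ _ (fun w => laplace_kernel z (X (t - s) w)) _
  (fun j => expR (- (s * G (j%:R * z)))) (fun j => expR (- ((t - s) * G (j%:R * z))))).
all: try exact: measurable_laplace_kernel.
all: try by move=> w; exact: laplace_kernel_itv (ltW z0) (X0 _ w).
- by move=> j; exact: mom.
- by move=> j; apply: mom; rewrite subr_ge0.
- by move=> j; rewrite mom// -expRD; congr (expR _)%:E; ring.
Qed.

End levy_tail.

(** * Independence of groups of random variables *)

Lemma bigcapT_D1 (T : Type) (K : choiceType) (E : K -> set T) a :
  \bigcap_(k in [set: K]) E k = E a `&` \bigcap_(k in [set k | k != a]) E k.
Proof.
apply/seteqP; split=> [w h|w [ha h] k _]; first by split=> [|k _]; exact: h.
by have [->//|ka] := eqVneq k a; exact: h.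
Qed.

Section independence.
Context (R : realType) d (W : measurableType d) (P : probability W R).

(** Dynkin's pi-lambda argument, applied to one index at a time. *)
Lemma prob_bigcap_sigma_algebra (K : finType) (Gs : K -> set (set W)) :
  (forall k, Gs k `<=` measurable) -> (forall k, setI_closed (Gs k)) ->
  (forall k, Gs k setT) ->
  (forall E, (forall k, Gs k (E k)) ->
     P (\bigcap_(k in [set: K]) E k) = (\prod_(k : K) P (E k))%E) ->
  forall E, (forall k, <<s Gs k >> (E k)) ->
    P (\bigcap_(k in [set: K]) E k) = (\prod_(k : K) P (E k))%E.
Proof.
move=> mG GI GT hG.
have mS k A : <<s Gs k >> A -> measurable A.
  apply: smallest_sub; last exact: mG.
  exact: sigma_algebra_measurable.
have fin A : measurable A -> P A \is a fin_num by move=> mA; exact: fin_num_measure.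
(* [s] lists the indices whose event may already be any set of the generated sigma-algebra; the
   other events still come from the pi-systems. *)
suff h (s : seq K) E : (forall k, if k \in s then <<s Gs k >> (E k) else Gs k (E k)) ->
    P (\bigcap_(k in [set: K]) E k) = (\prod_(k : K) P (E k))%E.
  move=> E hE; apply: (h (enum K)) => k; rewrite mem_enum; exact: hE.
elim: s E => [|a s IH] E hE; first by apply: hG => k; have := hE k.
have [ains|aNs] := boolP (a \in s).
  by apply: IH => k; have := hE k; rewrite inE; case: eqP => // ->; rewrite ?ains /=.
pose c : \bar R := (\prod_(k | k != a) P (E k))%E.
pose rest := \bigcap_(k in [set k | k != a]) E k.
have mE k : k != a -> measurable (E k).
  move=> ka; have := hE k; rewrite inE (negbTE ka)/=.
  by case: ifP => _; [exact: mS|exact: mG].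
have mrest : measurable rest by apply: fin_bigcap_measurable => //; exact: finite_finset.
have fc : c \is a fin_num by apply: prode_fin_num => k ka; apply/fin/mE.
have Gprod A : Gs a A -> P (A `&` rest) = (P A * c)%E.
  move=> GA; pose E' k := if k == a then A else E k.
  have E'a : E' a = A by rewrite /E' eqxx.
  have -> : A `&` rest = \bigcap_(k in [set: K]) E' k.
    rewrite (bigcapT_D1 _ a) E'a; congr (_ `&` _).
    by apply: eq_bigcapr => k /= ka; rewrite /E' (negbTE ka).
  rewrite IH; last first.
    move=> k; rewrite /E'; case: eqP => [->|/eqP ka]; first by rewrite (negbTE aNs).
    by have := hE k; rewrite inE (negbTE ka).
  rewrite (bigD1 a)//= E'a; congr (_ * _)%E.
  by apply: eq_bigr => k ka; rewrite /E' (negbTE ka).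
(* Since [setT] belongs to [Gs a], the product formula also gives the probability of [rest]. *)
have Prest : P rest = c.
  have := Gprod _ (GT a); rewrite setTI => ->.
  by rewrite [X in (X * _)%E](probability_setT P) mul1e.
rewrite (bigcapT_D1 _ a) (bigD1 a)//= -/c -/rest.
(* For a fixed [rest], the sets obeying the product formula form a lambda-system containing
   [Gs a]. *)
suff : <<s Gs a >> `<=` [set A | measurable A /\ P (A `&` rest) = (P A * c)%E].
  by move=> /(_ (E a)) []; first by have := hE a; rewrite inE eqxx.
apply: lambda_system_subset => //.
- apply/dynkin_lambda_system; split.
  + by split=> //; rewrite setTI Prest [X in (X * _)%E](probability_setT P) mul1e.
  + move=> A [mA hA]; split; first exact: measurableC.
    rewrite setIC -setDE measureD ?ltey_eq ?fin//.
    rewrite probability_setC// [rest `&` A]setIC [X in (X - _)%E]Prest [X in (_ - X)%E]hA muleBl ?mul1e//.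
  + move=> F tF hF.
    have mF n : measurable (F n) by case: (hF n).
    split; first exact: bigcup_measurable.
    rewrite setI_bigcupl !measure_bigcup//.
    * rewrite muleC -(fineK fc) -nneseriesZl//; apply: eq_eseriesr => n _.
      by case: (hF n) => _ hn; rewrite fineK// muleC.
    * by move=> n _; exact: measurableI.
    * by apply: trivIset_setIr.
- by move=> A GA; split; [exact: mG GA|exact: Gprod].
Qed.

(** A pi-system generating the sigma-algebra of the variables of group [k]. *)
Definition group_cylinders (J : finType) (K : eqType) (Z : J -> W -> R) (g : J -> K) (k : K) :
    set (set W) :=
  [set \bigcap_(j in [set j | g j = k]) Z j @^-1` B j |
     B in [set B : J -> set R | forall j, measurable (B j)]].

Lemma prob_bigcap_group (J K : finType) (Z : J -> W -> R) (g : J -> K) :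
  (forall j, measurable_fun setT (Z j)) -> mutually_independent P Z ->
  forall E, (forall k, <<s group_cylinders Z g k >> (E k)) ->
    P (\bigcap_(k in [set: K]) E k) = (\prod_(k : K) P (E k))%E.
Proof.
move=> mZ hZ; apply: prob_bigcap_sigma_algebra.
- move=> k _ [B mB <-]; apply: fin_bigcap_measurable; first exact: finite_finset.
  by move=> j _; rewrite -[X in measurable X]setTI; exact: mZ.
- move=> k _ _ [B mB <-] [C mC <-]; exists (fun j => B j `&` C j).
    by move=> j; exact: measurableI.
  by rewrite bigcapI.
- by move=> k; exists (fun=> setT) => //; apply/seteqP; split.
move=> E hE.
have {}hE k : {B : J -> set R | (forall j, measurable (B j)) /\
    \bigcap_(j in [set j | g j = k]) Z j @^-1` B j = E k}.
  by apply: cid; have [B mB eB] := hE k; exists B.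
pose B k := sval (hE k).
have mB k j : measurable (B k j) by rewrite /B; case: (hE k) => ? [].
have EB k : E k = \bigcap_(j in [set j | g j = k]) Z j @^-1` B k j.
  by rewrite /B; case: (hE k) => ? [].
have -> : \bigcap_(k in [set: K]) E k = \bigcap_(j in [set: J]) Z j @^-1` B (g j) j.
  apply/seteqP; split=> w h.
    by move=> j _; have := h (g j) I; rewrite EB; exact.
  by move=> k _; rewrite EB => j /= <-; exact: h.
rewrite hZ// (partition_big g xpredT)//=; apply: eq_bigr => k _.
(* Padding with [setT] outside the group turns the cylinder into an event indexed by all of [J], to
   which [hZ] applies. *)
pose C j := if g j == k then B k j else setT.
have -> : E k = \bigcap_(j in [set: J]) Z j @^-1` C j.
  rewrite EB; apply/seteqP; split=> w h j.
    by rewrite /C; case: eqP => // gj _; exact: h.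
  by move=> /= gj; have := h j I; rewrite /C gj eqxx.
rewrite hZ; last by move=> j; rewrite /C; case: ifP.
rewrite [RHS](bigID (fun j => g j == k))/= [X in (_ * X)%E]big1 ?mule1.
  by apply: eq_bigr => j /eqP gj; rewrite /C gj eqxx.
by move=> j gj; rewrite /C (negbTE gj) preimage_setT; exact: probability_setT.
Qed.

End independence.

Lemma measurable_group_cylinders (R : realType) d (W : measurableType d) (J : finType)
    (K : eqType) (Z : J -> W -> R) (g : J -> K) (k : K) j : g j = k ->
  measurable_fun [set: g_sigma_algebraType (group_cylinders Z g k)] (Z j).
Proof.
move=> gj _ B mB; rewrite setTI; apply: sub_sigma_algebra.
exists (fun i => if i == j then B else setT); first by move=> i /=; case: ifP.
apply/seteqP; split=> w /=; first by move=> /(_ j gj); rewrite eqxx.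
by move=> h i _; case: eqP => // ->.
Qed.

(** * The level function *)

Lemma exp1_rv_gt (R : realType) d (W : measurableType d) (P : probability W R)
    (Y : W -> R) (y : R) : exp1_rv P Y -> 0 <= y ->
  P [set w | y < Y w] = (expR (- y))%:E.
Proof.
move=> [mY hY] y0.
have mle : measurable (Y @^-1` `]-oo, y]) by rewrite -[X in measurable X]setTI; exact: mY.
have -> : [set w | y < Y w] = ~` (Y @^-1` `]-oo, y]).
  by apply/seteqP; split=> w /=; rewrite in_itv/= ltNge => /negP.
rewrite probability_setC// hY//.
have -> : `]-oo, y] `&` `[0, +oo[ = `[0, y]%classic :> set R.
  apply/seteqP; split=> z /=; rewrite !in_itv/= andbT; first by move=> [-> ->].
  by move=> /andP[-> ->].
have [y1|] := ltP 0 y; last first.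
  move=> y1; have -> : y = 0 by apply/eqP; rewrite eq_le y0 y1.
  by rewrite set_itv1 integral_set1 sube0 oppr0 expR0.
have -> : (\int[lebesgue_measure]_(x in `[0%R, y]) (expR (- x))%:E)%E =
           exponential_prob 1 `[0, y].
  apply: eq_integral => x; rewrite inE/= in_itv/= => /andP[x0 _].
  by rewrite exponential_pdfE// mul1r mulN1r.
by rewrite exponential_prob_itv0c// mulN1r -!EFinB subKr.
Qed.

Lemma uniform01_rv_gt (R : realType) d (W : measurableType d) (P : probability W R)
    (U : W -> R) (c : R) : uniform01_rv P U -> 0 <= c <= 1 ->
  P [set w | c < U w] = (1 - c)%:E.
Proof.
move=> [mU hU] /andP[c0 c1].
have -> : [set w | c < U w] = U @^-1` `]c, +oo[.
  by apply/seteqP; split=> w /=; rewrite in_itv/= andbT.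
rewrite hU//.
have -> : `]c, +oo[ `&` `[0, 1] = `]c, 1]%classic :> set R.
  apply/seteqP; split=> z /=; rewrite !in_itv/= andbT; first by move=> [-> /andP[_ ->]].
  by move=> /andP[cz z1]; rewrite cz z1 (le_trans c0)// ltW.
rewrite lebesgue_measure_itv/= lte_fin; case: ltP => c1'; first by rewrite EFinB.
by have -> : c = 1; [apply/eqP; rewrite eq_le c1 c1'|rewrite subrr].
Qed.

(** By independence the law of [(M, U)] is the product of its marginals; integrating over [U] first,
    with [M] frozen at [c], leaves [P(c < U) = 1 - c]. *)
Lemma prob_lt_uniform01 (R : realType) d (W : measurableType d) (P : probability W R)
    (M U : W -> R) : measurable_fun setT M -> (forall w, 0 <= M w <= 1) ->
  uniform01_rv P U ->
  (forall A B, measurable A -> measurable B ->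
    P (M @^-1` A `&` U @^-1` B) = (P (M @^-1` A) * P (U @^-1` B))%E) ->
  P [set w | M w < U w] = (\int[P]_w (1 - M w)%:E)%E.
Proof.
move=> mM M01 uU ind; have [mU _] := uU.
have mMU : measurable_fun setT (fun w => (M w, U w)) by exact: measurable_fun_pair.
pose lawM := distribution P (mfun_Sub (mem_set mM)).
pose lawU := distribution P (mfun_Sub (mem_set mU)).
pose law := distribution P (mfun_Sub (mem_set mMU)).
pose S := [set z : R * R | z.1 < z.2].
have mS : measurable S.
  have -> : S = (fun z : R * R => z.1 < z.2) @^-1` [set true] by apply/seteqP; split.
  rewrite -[X in measurable X]setTI.
  by apply: (measurable_fun_ltr (f := fst) (g := snd)) => //.
have -> : P [set w | M w < U w] = law S by [].
have <- : ((lawM \x lawU) S = law S)%E.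
  exact: product_measure_unique.
transitivity (\int[P]_w ((lawU \o xsection S) (M w)))%E.
  rewrite /product_measure1/=.
  rewrite (@ge0_integral_distribution _ _ _ _ _ P (mfun_Sub (mem_set mM)) (lawU \o xsection S))//.
  exact: measurable_fun_xsection.
apply: eq_integral => w _ /=.
rewrite -(uniform01_rv_gt uU (M01 w)); congr (P _); apply/seteqP; split=> w'.
  by rewrite /preimage/= xsectionE.
by move=> h; rewrite /preimage/= xsectionE.
Qed.

Section levy_level_tail.
Context (R : realType) (G : R -> R) (d : measure_display) (W : measurableType d).
Context (PX : probability W R) (X : R -> W -> \bar R).
Hypothesis hX : levy_process_of G PX X.

Definition tail t a : R := fine (PX [set w | (a%:E <= X t w)%E]).

Lemma tailE t a : PX [set w | (a%:E <= X t w)%E] = (tail t a)%:E.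
Proof. by rewrite fineK//; apply: fin_num_measure; exact: (tail_measurable hX). Qed.

Lemma tail_itv t a : 0 <= tail t a <= 1.
Proof.
rewrite -!lee_fin -tailE measure_ge0/= probability_le1//.
exact: (tail_measurable hX).
Qed.

Lemma tail_homo s t a : 0 <= s -> s <= t -> tail s a <= tail t a.
Proof. by move=> s0 st; rewrite -lee_fin -!tailE (tail_homo_time hX). Qed.

Lemma tail_anti t : nonincreasing_fun (tail t).
Proof.
move=> a b ab; rewrite -lee_fin -!tailE; apply: le_measure.
- by rewrite inE; exact: (tail_measurable hX).
- by rewrite inE; exact: (tail_measurable hX).
- by move=> w /=; apply: le_trans; rewrite lee_fin.
Qed.

Lemma measurable_tail d' (T : measurableType d') t (f : T -> R) :
  measurable_fun setT f -> measurable_fun setT (fun w => tail t (f w)).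
Proof.
move=> mf; apply: (measurableT_comp (f := tail t)) => //.
by apply: nonincreasing_measurable => //; exact: tail_anti.
Qed.

(** The default 0 is neutral because tails are non-negative; for a coordinate without updates it
    lies almost surely below a uniform hash. *)
Definition max_tail (I : finType) (Q : pred I) t (a : I -> R) : R :=
  \big[Num.max/0]_(i | Q i) tail t (a i).

Lemma max_tail_itv (I : finType) (Q : pred I) t (a : I -> R) : 0 <= max_tail Q t a <= 1.
Proof.
rewrite bigmax_ge_id/=; apply/bigmax_leP; split=> // i _.
by have /andP[] := tail_itv t (a i).
Qed.

Lemma max_tail_homo (I : finType) (Q : pred I) s t (a : I -> R) : 0 <= s -> s <= t ->
  max_tail Q s a <= max_tail Q t a.
Proof. by move=> s0 st; apply: le_bigmax2 => i _; exact: tail_homo. Qed.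

(* The events [X_t < a i] are nested. *)
Lemma prob_below_all (I : finType) (Q : pred I) t (a : I -> R) :
  PX [set w | forall i, Q i -> (X t w < (a i)%:E)%E] = (1 - max_tail Q t a)%:E.
Proof.
have [i0 Qi0|Q0] := pickP Q; last first.
  have -> : [set w | forall i, Q i -> (X t w < (a i)%:E)%E] = setT.
    by apply/seteqP; split=> w //= _ i; rewrite Q0.
  by rewrite /max_tail big_pred0// subr0 probability_setT.
(* The smallest threshold has the largest tail and decides both sides. *)
have [j Qj jmin] := arg_minP a Qi0.
have -> : max_tail Q t a = tail t (a j).
  apply/eqP; rewrite eq_le; apply/andP; split; last exact: le_bigmax_cond.
  apply/bigmax_leP; split; first by have /andP[] := tail_itv t (a j).
  by move=> i Qi; apply: tail_anti; exact: jmin.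
have -> : [set w | forall i, Q i -> (X t w < (a i)%:E)%E] =
    ~` [set w | ((a j)%:E <= X t w)%E].
  apply/seteqP; split=> w /=.
    by move=> h; apply/negP; rewrite -ltNge; exact: h.
  move/negP; rewrite -ltNge => h i Qi; apply: lt_le_trans h _.
  by rewrite lee_fin; exact: jmin.
by rewrite probability_setC ?tailE//; exact: (tail_measurable hX).
Qed.

Lemma measurable_max_tail d' (T : measurableType d') (I : finType) (Q : pred I) t
    (f : I -> T -> R) : (forall i, Q i -> measurable_fun setT (f i)) ->
  measurable_fun setT (fun w => max_tail Q t (f ^~ w)).
Proof.
move=> mf; rewrite /max_tail; elim: (index_enum I) => [|i s IH].
  have -> : (fun w => \big[Num.max/0]_(i <- [::] | Q i) tail t (f i w)) = cst 0.
    by apply/funext => w; rewrite big_nil.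
  exact: measurable_cst.
have [Qi|NQi] := boolP (Q i); last first.
  have -> : (fun w => \big[Num.max/0]_(j <- i :: s | Q j) tail t (f j w)) =
            (fun w => \big[Num.max/0]_(j <- s | Q j) tail t (f j w)) => //.
  by apply/funext => w; rewrite big_cons (negbTE NQi).
have -> : (fun w => \big[Num.max/0]_(j <- i :: s | Q j) tail t (f j w)) =
    (fun w => Num.max (tail t (f i w)) (\big[Num.max/0]_(j <- s | Q j) tail t (f j w))).
  by apply/funext => w; rewrite big_cons Qi.
by apply: measurable_maxr => //; apply: measurable_tail; exact: mf.
Qed.

(** By monotonicity no time before [s] is admissible. Right-continuity of the tail in time is not
    established, hence the weak inequality; the gap [t < t'] in [late_sub_sampled] makes up for
    it. *)
Lemma levy_level_gt s a b : 0 <= s -> tail s a < b -> (s%:E <= levy_level PX X a b)%E.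
Proof.
move=> s0 sb; apply: le_ereal_inf_tmp => _ [t [t0 bt] <-].
rewrite lee_fin leNgt; apply/negP => ts.
move: bt; rewrite tailE lee_fin leNgt => /negP; apply.
by apply: le_lt_trans sb; apply: tail_homo => //; exact: ltW.
Qed.

Lemma levy_level_le t a b : 0 <= t -> b <= tail t a -> (levy_level PX X a b <= t%:E)%E.
Proof.
move=> t0 bt; apply: ge_ereal_inf; exists t%:E => //; exists t => //; split=> //.
by rewrite tailE lee_fin.
Qed.

(** Monotonicity lets a rational time replace the real one, so the event is a countable union, as
    measurability requires. *)
Lemma levy_level_ltP a b r : (levy_level PX X a b < r%:E)%E <->
  exists q : rat, [/\ 0 <= ratr q :> R, ratr q < r & b <= tail (ratr q) a].
Proof.
split=> [/ereal_inf_lt[_ [t [t0 bt] <-]]|[q [q0 qr bq]]].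
  rewrite lte_fin => /rat_in_itvoo[q]; rewrite in_itv/= => /andP[tq qr].
  exists q; split=> //; first by rewrite (le_trans t0)// ltW.
  move: bt; rewrite tailE lee_fin => /le_trans; apply.
  by apply: tail_homo => //; exact: ltW.
by apply: le_lt_trans (levy_level_le q0 bq) _; rewrite lte_fin.
Qed.

Lemma measurable_levy_level d' (T : measurableType d') (a b : T -> R) :
  measurable_fun setT a -> measurable_fun setT b ->
  measurable_fun setT (fun w => levy_level PX X (a w) (b w)).
Proof.
move=> ma mb; apply: (measurability (@ErealGenInftyO.G R)).
  exact: ErealGenInftyO.measurableE.
move=> _ [_ [r] -> <-]; apply: measurableI => //.
have -> : (fun w => levy_level PX X (a w) (b w)) @^-1` `]-oo, r%:E[ =
  \bigcup_(q : rat) (if (0 <= ratr q :> R) && (ratr q < r)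
     then [set w | b w <= tail (ratr q) (a w)] else set0).
  apply/seteqP; split=> w /=; rewrite in_itv/=.
    move=> /levy_level_ltP[q [q0 qr h]]; exists q => //=; by rewrite q0 qr.
  move=> [q _]; case: ifPn => // /andP[q0 qr] h.
  by apply/levy_level_ltP; exists q.
apply: bigcupT_measurable_rat => q; case: ifP => // _.
rewrite -[X in measurable X]setTI.
have -> : [set w | b w <= tail (ratr q) (a w)] =
   (fun w => b w <= tail (ratr q) (a w)) @^-1` [set true] by apply/seteqP; split.
by apply: measurable_fun_ler => //; exact: measurable_tail.
Qed.

End levy_level_tail.

(** * The minimal hash of a coordinate *)

(** At [x = +oo] the kernel is the indicator of [z = 0], and a sum of non-negative terms vanishes
    only if each term does; this is why non-negativity is carried through the induction. *)
Lemma prod_laplace_kernel (R : realType) (I : finType) (Q : pred I) (z : I -> R) x :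
  (forall i, 0 <= z i) -> (0 <= x)%E ->
  \prod_(i | Q i) laplace_kernel (z i) x = laplace_kernel (\sum_(i | Q i) z i) x.
Proof.
move=> z0 x0.
suff [] : 0 <= \sum_(i | Q i) z i /\
  \prod_(i | Q i) laplace_kernel (z i) x = laplace_kernel (\sum_(i | Q i) z i) x by [].
elim/big_rec2: _ => [|i y1 y2 _ [y0 ->]].
  by split=> //; case: x x0 => [r||]//= _; rewrite ?mul0r ?oppr0 ?expR0 ?eqxx.
split; first exact: addr_ge0.
case: x x0 => [r||]//= _; first by rewrite -expRD mulrDl opprD.
by rewrite paddr_eq0//; case: (z i == 0); rewrite ?mul1r ?mul0r.
Qed.

Section sampler_events.
Context (R : realType) (G : R -> R) (d1 : measure_display) (W1 : measurableType d1).
Context (PX : probability W1 R) (X : R -> W1 -> \bar R).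
Hypothesis hX : levy_process_of G PX X.
Context (n m : nat) (v : 'I_m -> 'I_n) (Delta : 'I_m -> R).
Hypothesis hDelta : forall i, 0 < Delta i.
Context (d2 : measure_display) (W : measurableType d2) (P : probability W R).
Context (H : 'I_n -> W -> R) (Y : 'I_m -> W -> R).
Hypothesis hH : forall u, uniform01_rv P (H u).
Hypothesis hY : forall i, exp1_rv P (Y i).
Let Z (j : 'I_n + 'I_m) : W -> R := match j with inl u => H u | inr i => Y i end.
Hypothesis hind : mutually_independent P Z.

Lemma measurable_HY j : measurable_fun setT (Z j).
Proof. by case: j => [u|i]; [case: (hH u)|case: (hY i)]. Qed.

(** Each [Y i / Delta i] is exponential of rate [Delta i], and independence multiplies the tails. At
    [x = +oo] the event is empty if [u] is updated and the whole space otherwise, in agreement with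
    [laplace_kernel]. *)
Lemma prob_all_exp_gt u (x : \bar R) : (0 <= x)%E ->
  P [set w | forall i, v i == u -> (x < (Y i w / Delta i)%:E)%E] =
  (laplace_kernel (\sum_(i | v i == u) Delta i) x)%:E.
Proof.
move=> x0; rewrite -prod_laplace_kernel//; last by move=> i; exact: ltW.
pose S i : set R := [set y | (x < (y / Delta i)%:E)%E].
have SE i : S i = if x is r%:E then `]r * Delta i, +oo[%classic else set0.
  rewrite /S; case: x x0 {S} => [r||]//= _; apply/seteqP; split=> y //=.
    by rewrite in_itv/= andbT lte_fin ltr_pdivlMr.
  by rewrite in_itv/= andbT lte_fin ltr_pdivlMr.
have mS i : measurable (S i) by rewrite SE; case: (x).
pose B (j : 'I_n + 'I_m) := match j with inl _ => setT | inr i => if v i == u then S i else setT end.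
have -> : [set w | forall i, v i == u -> (x < (Y i w / Delta i)%:E)%E] =
    \bigcap_(j in setT) Z j @^-1` B j.
  apply/seteqP; split=> w /= h; first by move=> [u'|i]//= _; case: ifP => //; exact: h.
  by move=> i vi; have := h (inr i) I; rewrite /= vi.
rewrite hind; last by move=> [u'|i] /=; [exact: measurableT|case: (v i == u)].
rewrite big_sumType/= big1 ?mul1e; last first.
  by move=> u' _; rewrite preimage_setT; exact: probability_setT.
rewrite (bigID (fun i => v i == u))/= [X in (_ * X)%E]big1 ?mule1; last first.
  by move=> i /negbTE ->; rewrite preimage_setT; exact: probability_setT.
rewrite -prodEFin; apply: eq_bigr => i vi; rewrite vi SE.
case: x x0 {S SE mS B} => [r||]//= r0.
  have -> : Y i @^-1` `]r * Delta i, +oo[ = [set w | r * Delta i < Y i w].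
    by apply/seteqP; split=> w /=; rewrite in_itv/= andbT.
  by rewrite (exp1_rv_gt (hY i)) ?mulr_ge0// 1?mulrC// ltW.
by rewrite preimage_set0 measure0 gt_eqF.
Qed.

Definition hit_tail u t w := max_tail PX X (fun i => v i == u) t (fun i => Y i w / Delta i).

(* Up to a null set, the event that every [levy_level] drawn by the updates of [u] exceeds
   [t]; it is the whole space, again up to a null set, when [u] is never updated. *)
Definition late u t := [set w | hit_tail u t w < H u w].

(** The map [f] allows a change of sigma-algebra on [W]: taken as the identity from a
    [g_sigma_algebraType], it shows dependence on one group of variables only. *)
Lemma measurable_hit_tail d' (T : measurableType d') (f : T -> W) u t :
  (forall i, v i == u -> measurable_fun setT (Y i \o f)) ->
  measurable_fun setT (hit_tail u t \o f).
Proof.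
move=> mY.
apply: (@measurable_max_tail _ _ _ _ _ _ hX _ T _ (fun i => v i == u) t (fun i w => Y i (f w) / Delta i)) => i vi.
by apply: measurable_funM => //; exact: mY.
Qed.

Lemma late_measurable_sub d' (T : measurableType d') (f : T -> W) u t :
  measurable_fun setT (H u \o f) ->
  (forall i, v i == u -> measurable_fun setT (Y i \o f)) ->
  measurable (f @^-1` late u t).
Proof.
move=> mH mY; rewrite -[X in measurable X]setTI.
have -> : f @^-1` late u t = (fun w => hit_tail u t (f w) < H u (f w)) @^-1` [set true].
  by apply/seteqP; split.
by apply: measurable_fun_ltr => //; exact: measurable_hit_tail.
Qed.

Lemma measurable_late u t : measurable (late u t).
Proof.
apply: (late_measurable_sub (f := idfun)); first by case: (hH u).
by move=> i _; case: (hY i).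
Qed.

(** The hash of [u] and the exponentials of the updates of [u] form one group, and [late u] depends
    on that group alone. *)
Lemma prob_late_product (t : 'I_n -> R) :
  P (\bigcap_(u in [set: 'I_n]) late u (t u)) = (\prod_(u < n) P (late u (t u)))%E.
Proof.
pose g (j : 'I_n + 'I_m) := match j with inl u => u | inr i => v i end.
apply: (@prob_bigcap_group _ _ _ P _ _ Z g measurable_HY hind) => u.
apply: (@late_measurable_sub _ (g_sigma_algebraType (group_cylinders Z g u)) idfun).
  exact: (@measurable_group_cylinders _ _ _ _ _ Z g u (inl u)).
by move=> i /eqP vi; exact: (@measurable_group_cylinders _ _ _ _ _ Z g u (inr i)).
Qed.

(** A second grouping, by kind: all hashes against all exponentials. *)
Lemma hit_tail_indep_hash u t A B : measurable A -> measurable B ->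
  P (hit_tail u t @^-1` A `&` H u @^-1` B) =
  (P (hit_tail u t @^-1` A) * P (H u @^-1` B))%E.
Proof.
move=> mA mB.
pose g (j : 'I_n + 'I_m) := match j with inl _ => true | inr _ => false end.
pose E b := if b then H u @^-1` B else hit_tail u t @^-1` A.
have := @prob_bigcap_group _ _ _ P _ _ Z g measurable_HY hind E.
rewrite big_bool/= muleC => <-.
  congr (P _); apply/seteqP; split=> w /=; first by move=> [h1 h2] [].
  by move=> h; split; [exact: (h false)|exact: (h true)].
case; rewrite /E -[X in <<s _ >> X]setTI.
  exact: (@measurable_group_cylinders _ _ _ _ _ Z g true (inl u)).
apply: (@measurable_hit_tail _ (g_sigma_algebraType (group_cylinders Z g false)) idfun) => //.
by move=> i vi; exact: (@measurable_group_cylinders _ _ _ _ _ Z g false (inr i)).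
Qed.

Lemma prob_late u t : 0 <= t ->
  P (late u t) = (expR (- (t * G (\sum_(i | v i == u) Delta i))))%:E.
Proof.
move=> t0; have [X0 mX hL] := hX.
rewrite (prob_lt_uniform01 _ _ (hH u)); last 3 first.
- apply: (measurable_hit_tail (f := idfun)) => i _; by case: (hY i).
- by move=> w; exact: (max_tail_itv hX).
- by move=> A B; exact: hit_tail_indep_hash.
rewrite -hL//; last by apply: sumr_ge0 => i _; exact: ltW.
pose A := [set z : W * W1 | forall i, v i == u -> (X t z.2 < (Y i z.1 / Delta i)%:E)%E].
have mA : measurable A.
  have -> : A = \bigcap_(i in [set i | v i == u])
      (setT `&` [set z : W * W1 | (X t z.2 < (Y i z.1 / Delta i)%:E)%E]).
    apply/seteqP; split=> z h i vi; first by split=> //; exact: h.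
    by have [_] := h i vi.
  apply: fin_bigcap_measurable; first exact: finite_finset.
  move=> i _; apply: measurable_lte => //; first exact: measurableT_comp.
  apply/measurable_EFinP; apply: measurable_funM => //.
  by apply: (measurableT_comp (f := Y i)) => //; case: (hY i).
(* Integrating [A] over the process first, with the exponentials frozen, gives [1 - hit_tail]. *)
have -> : (\int[P]_w (1 - hit_tail u t w)%:E)%E = (P \x PX)%E A.
  apply: eq_integral => w _ /=; rewrite /hit_tail -(prob_below_all hX).
  by congr (PX _); rewrite xsectionE.
(* Fubini: now the process is frozen and the exponentials are integrated first. *)
have -> : (P \x PX)%E A = (P \x^ PX)%E A.
  by apply: product_measure_unique => //= ? ? ? ?; rewrite product_measure2E.
apply: eq_integral => w _ /=; rewrite -prob_all_exp_gt//.
by congr (P _); rewrite ysectionE.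
Qed.

End sampler_events.

(** * Runs of the data structure *)

Section ds_run_theory.
Context (R : realType) (n : nat).
Implicit Types (s : seq ('I_n * \bar R)) (u : 'I_n).

Lemma ds_run_rcons s p : ds_run (rcons s p) = ds_step (ds_run s) p.
Proof. by rewrite /ds_run foldl_rcons. Qed.

Lemma ds_run_le s p : p \in s -> ((ds_run s).2 <= p.2)%E.
Proof.
elim/last_ind: s p => // s q IH p; rewrite mem_rcons inE ds_run_rcons /ds_step.
case: ifPn => [lt|/=]; last rewrite -leNgt => ge.
  by move=> /predU1P[->//|/IH]; apply: le_trans; exact: ltW.
by move=> /predU1P[->//|/IH].
Qed.

Lemma ds_run_mem s :
  match (ds_run s).1 with
  | Some u => is_true ((u, (ds_run s).2) \in s)
  | None => (ds_run s).2 = +oo%E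
  end.
Proof.
elim/last_ind: s => // s q; rewrite ds_run_rcons /ds_step; case: ifPn => _ /=.
  by rewrite mem_rcons inE -surjective_pairing eqxx.
by case: (ds_run s).1 => // u; rewrite mem_rcons inE => ->; rewrite orbT.
Qed.

(** The final hash is at most [t] and, being finite, was produced by some update; only updates of
    [u] produce such a hash. *)
Lemma ds_run_some s u t p : p \in s -> p.1 = u -> (p.2 <= t%:E)%E ->
  (forall q, q \in s -> q.1 != u -> (t%:E < q.2)%E) -> (ds_run s).1 = Some u.
Proof.
move=> ps pu pt h; have le := le_trans (ds_run_le ps) pt; have := ds_run_mem s.
case: (ds_run s).1 => [u' us|e]; last by move: le; rewrite e.
have [->//|u'u] := eqVneq u' u.
by have := h _ us u'u; rewrite /= ltNge le.
Qed.

Lemma ds_run_measurable d (W : measurableType d) (I : eqType) (s : seq I) (v : I -> 'I_n)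
    (f : I -> W -> \bar R) u : (forall i, measurable_fun setT (f i)) ->
  measurable [set w | (ds_run [seq (v i, f i w) | i <- s]).1 = Some u].
Proof.
move=> mf.
(* The induction also carries the stored hash, with which the next update is compared. *)
suff [] : measurable_fun setT (fun w => (ds_run [seq (v i, f i w) | i <- s]).2) /\
  measurable [set w | (ds_run [seq (v i, f i w) | i <- s]).1 = Some u] by [].
elim/last_ind: s => [|s i [IH2 IH1]].
  split; first exact: measurable_cst.
  have -> : [set w : W | (ds_run [seq (v i, f i w) | i <- [::]]).1 = Some u] = set0.
    by apply/seteqP; split.
  exact: measurable0.
pose st w := ds_run [seq (v i, f i w) | i <- s].
have stE w : ds_run [seq (v i, f i w) | i <- rcons s i] = ds_step (st w) (v i, f i w).
  by rewrite map_rcons ds_run_rcons.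
have mlt : measurable [set w | (f i w < (st w).2)%E].
  by rewrite -[X in measurable X]setTI; exact: measurable_lte.
split.
  have -> : (fun w => (ds_run [seq (v i, f i w) | i <- rcons s i]).2) =
      (fun w => mine (f i w) (st w).2).
    by apply/funext => w; rewrite stE /ds_step /Order.min /=; case: ifP.
  exact: measurable_mine.
have -> : [set w | (ds_run [seq (v i, f i w) | i <- rcons s i]).1 = Some u] =
   ([set w | (f i w < (st w).2)%E] `&` (if v i == u then setT else set0)) `|`
   (~` [set w | (f i w < (st w).2)%E] `&` [set w | (st w).1 = Some u]).
  apply/seteqP; split=> w /=; rewrite stE /ds_step /=.
    case: ifPn => lt /= e; last by right.
    by left; split=> //; case: e => ->; rewrite eqxx.
  move=> [[lt]|[/negP/negbTE -> //]].
  by rewrite lt; case: eqP => // ->.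
apply: measurableU; last by apply: measurableI => //; exact: measurableC.
by apply: measurableI => //; case: ifP.
Qed.

End ds_run_theory.

(** For independent exponentials of rates [l] and [L], the summand is the probability that the first
    lies in the cell from [k e] to [(k + 1) e] and the second beyond [(k + 2) e]. The series is
    geometric of ratio [exp (- (l + L) e)]; multiplying by [1 - q <= (l + L) e] avoids dividing by
    [1 - q]. *)
Lemma geometric_lower_bound (R : realType) (l L e p : R) N :
  0 <= l -> 0 <= L -> 0 < l + L -> 0 < e ->
  \sum_(k < N) (expR (- (k%:R * e * l + k.+2%:R * e * L)) -
                expR (- (k.+1%:R * e * l + k.+2%:R * e * L))) <= p ->
  l * (1 - 2 * e * (l + L) - expR (- ((l + L) * e * N%:R))) <= (l + L) * p.
Proof.
move=> l0 L0; set S := l + L => S0 e0 hp.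
pose q := expR (- (S * e)).
have qN k : q ^+ k = expR (- (S * e * k%:R)) by rewrite -expRM_natr mulNr.
have term k : expR (- (k%:R * e * l + k.+2%:R * e * L)) -
    expR (- (k.+1%:R * e * l + k.+2%:R * e * L)) =
    expR (- (2 * e * L)) * (1 - expR (- (e * l))) * q ^+ k.
  rewrite qN mulrBr mulrBl mulr1 -!expRD; congr (expR _ - expR _);
  by rewrite /S -!natr1; ring.
move: hp; under eq_bigr do rewrite term; rewrite -mulr_sumr => hp.
have geo : (1 - q) * \sum_(k < N) q ^+ k = 1 - q ^+ N.
  by rewrite -opprB mulNr -subrX1 opprB.
have q0 : 0 < q := expR_gt0 _.
have q1 : q <= 1 by rewrite expR_le1 oppr_le0 mulr_ge0// ltW.
have qN1 : q ^+ N <= 1 by rewrite exprn_ile1// ltW.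
have h1 : 1 - q <= S * e by have := expR_ge1Dx (- (S * e)); rewrite -/q; lra.
have h2 : e * l * expR (- (e * l)) <= 1 - expR (- (e * l)).
  have := ler_wpM2r (expR_ge0 (- (e * l))) (expR_ge1Dx (e * l)).
  by rewrite expRxMexpNx_1 mulrDl mul1r; lra.
have p0 : 0 <= p.
  apply: le_trans hp; rewrite !mulr_ge0 ?expR_ge0//.
    by rewrite subr_ge0 expR_le1 oppr_le0 mulr_ge0// ltW.
  by apply: sumr_ge0 => k _; rewrite exprn_ge0// ltW.
have h3 : (1 - q) * p <= S * e * p by rewrite ler_wpM2r.
have h4 : expR (- (2 * e * L)) * (1 - expR (- (e * l))) * (1 - q ^+ N) <= (1 - q) * p.
  rewrite -geo mulrCA ler_wpM2l ?subr_ge0//.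
have h5 : expR (- (2 * e * L)) * (e * l * expR (- (e * l))) * (1 - q ^+ N) <= S * e * p.
  apply: le_trans h3; apply: le_trans h4.
  by rewrite ler_wpM2r ?subr_ge0// ler_wpM2l ?expR_ge0.
have h6 : 1 - 2 * e * S <= expR (- (2 * e * L)) * expR (- (e * l)).
  rewrite -expRD; apply: le_trans (expR_ge1Dx _).
  have : 0 <= e * l by rewrite mulr_ge0// ltW.
  by rewrite /S; lra.
have h7 : e * (l * (1 - 2 * e * S - q ^+ N)) <= e * (S * p).
  rewrite [leRHS](_ : _ = S * e * p); last by ring.
  apply: le_trans h5.
  have -> : expR (- (2 * e * L)) * (e * l * expR (- (e * l))) * (1 - q ^+ N) =
    e * (l * (expR (- (2 * e * L)) * expR (- (e * l)) * (1 - q ^+ N))) by ring.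
  rewrite !ler_wpM2l ?(ltW e0)//.
  (* Expanding the product leaves the non-negative extra term [2 e S q^N]. *)
  apply: (@le_trans _ _ ((1 - 2 * e * S) * (1 - q ^+ N))).
    have : 0 <= 2 * e * S * q ^+ N by rewrite !mulr_ge0 ?exprn_ge0 ?(ltW e0) ?(ltW S0) ?(ltW q0).
    by lra.
  by rewrite ler_wpM2r// subr_ge0.
by move: h7; rewrite qN ler_pM2l.
Qed.

(** Take [e = 1 / M] and [N = M^2]: the mesh shrinks while the horizon [e N = M] grows. *)
Lemma ler_of_geometric_bounds (R : realType) (l S r : R) : 0 <= l -> 0 < S ->
  (forall e N, 0 < e -> l * (1 - 2 * e * S - expR (- (S * e * N%:R))) <= r) -> l <= r.
Proof.
move=> l0 S0 h; rewrite leNgt; apply/negP => rl.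
have C0 : 0 < 2 * S + S^-1 by rewrite addr_gt0 ?mulr_gt0 ?invr_gt0.
(* As [exp (- S M) <= 1 / (S M)], the error is at most [l (2 S + 1 / S) / M]; this [M] makes it
   smaller than [l - r]. *)
pose M := (Num.bound (l * (2 * S + S^-1) / (l - r))).+1.
have M0 : 0 < M%:R :> R by rewrite ltr0n.
have lr : 0 < l - r by rewrite subr_gt0.
have hM : l * (2 * S + S^-1) / (l - r) < M%:R.
  apply: lt_le_trans (archi_boundP _) _; first by rewrite !mulr_ge0// ?invr_ge0 ltW.
  by rewrite ler_nat.
have Minv : 0 < M%:R^-1 :> R by rewrite invr_gt0.
have := h M%:R^-1 (M ^ 2)%N Minv.
have -> : S * M%:R^-1 * (M ^ 2)%:R = S * M%:R.
  by rewrite natrX expr2 -!mulrA mulKf// gt_eqF.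
apply/negP; rewrite -ltNge.
have ex : expR (- (S * M%:R)) <= S^-1 * M%:R^-1.
  rewrite expRN -invfM lef_pV2 ?posrE ?expR_gt0 ?mulr_gt0// mulrC.
  by apply: le_trans (expR_ge1Dx _); rewrite mulrC; lra.
apply: (@lt_le_trans _ _ (l * (1 - 2 * M%:R^-1 * S - S^-1 * M%:R^-1))); last first.
  by rewrite ler_wpM2l// lerB.
have -> : l * (1 - 2 * M%:R^-1 * S - S^-1 * M%:R^-1) = l - l * (2 * S + S^-1) / M%:R by ring.
by rewrite ltrBrDr -ltrBrDl ltr_pdivrMr// [ltRHS]mulrC -ltr_pdivrMr.
Qed.

(** * The law of the sample *)

Section sampler_lower_bound.
Context (R : realType) (G : R -> R) (d1 : measure_display) (W1 : measurableType d1).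
Context (PX : probability W1 R) (X : R -> W1 -> \bar R).
Hypothesis hX : levy_process_of G PX X.
Context (n m : nat) (v : 'I_m -> 'I_n) (Delta : 'I_m -> R).
Hypothesis hDelta : forall i, 0 < Delta i.
Context (d2 : measure_display) (W : measurableType d2) (P : probability W R).
Context (H : 'I_n -> W -> R) (Y : 'I_m -> W -> R).
Hypothesis hH : forall u, uniform01_rv P (H u).
Hypothesis hY : forall i, exp1_rv P (Y i).
Hypothesis hind : mutually_independent P
  (fun j : 'I_n + 'I_m => match j with inl u => H u | inr i => Y i end).

Local Notation late := (late PX X v Delta H Y).
Local Notation rate u := (G (\sum_(i | v i == u) Delta i)).

Definition sampled u := [set w |
  (ds_run [seq (v i, levy_level PX X (Y i w / Delta i) (H (v i) w)) | i <- enum 'I_m]).1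
  = Some u].

Lemma rate_ge0 u : 0 <= rate u.
Proof. by apply: (laplace_exponent_ge0 hX); apply: sumr_ge0 => i _; exact: ltW. Qed.

Lemma measurable_sampled u : measurable (sampled u).
Proof.
apply: (@ds_run_measurable _ _ _ _ _ (enum 'I_m) v
  (fun i w => levy_level PX X (Y i w / Delta i) (H (v i) w))) => i.
apply: (measurable_levy_level hX); last by case: (hH (v i)).
by apply: measurable_funM => //; case: (hY i).
Qed.

Lemma late_anti u s t : 0 <= s -> s <= t -> late u t `<=` late u s.
Proof.
by move=> s0 st w; rewrite /late/=; apply: le_lt_trans; exact: (max_tail_homo hX).
Qed.

Lemma late_sub_sampled u s t t' w : 0 <= s -> s <= t -> t < t' ->
  late u s w -> ~ late u t w -> (forall u', u' != u -> late u' t' w) -> sampled u w.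
Proof.
move=> s0 st tt' us ut ht'.
have t0 := le_trans s0 st.
(* Lateness at [s] forces [H u w > 0], so failing to be late at [t] is due to an actual update and
   not to the default 0 of the maximum. *)
have [i vi hi] : exists2 i, v i == u & H u w <= tail PX X t (Y i w / Delta i).
  apply: contrapT => h; apply: ut; apply/bigmax_ltP; split.
    apply: le_lt_trans us.
    by case/andP: (max_tail_itv hX (fun i => v i == u) s (fun i => Y i w / Delta i)).
  by move=> i vi; rewrite ltNge; apply/negP => hi; apply: h; exists i.
set f := fun i => (v i, levy_level PX X (Y i w / Delta i) (H (v i) w)).
apply: (@ds_run_some _ _ [seq f i | i <- enum 'I_m] u t (f i)).
- by apply/map_f; rewrite mem_enum.
- exact/eqP.
- by rewrite /= (eqP vi); exact: (levy_level_le hX).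
move=> _ /mapP[j _ ->] /= vj.
apply: (@lt_le_trans _ _ t'%:E); first by rewrite lte_fin.
apply: (levy_level_gt hX); first by rewrite (le_trans t0)// ltW.
have /bigmax_ltP[_] := ht' _ vj; apply; exact: eqxx.
Qed.

Lemma prob_all_late (t : 'I_n -> R) : (forall u, 0 <= t u) ->
  P (\bigcap_(u in [set: 'I_n]) late u (t u)) = (expR (- \sum_u t u * rate u))%:E.
Proof.
move=> t0; rewrite (prob_late_product hX v Delta hH hY hind).
rewrite -sumrN expR_sum -prodEFin; apply: eq_bigr => u _.
by rewrite (prob_late hX v hDelta hH hY hind).
Qed.

(** The events [B k] place the least hash of [u] in the cell number [k] of the grid and all others
    beyond [(k + 2) e]. The empty cell in between provides the strict gap that [late_sub_sampled]
    asks for. *)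
Lemma sampled_ge u e N : 0 < e ->
  \sum_(k < N) (expR (- (k%:R * e * rate u + k.+2%:R * e * \sum_(u' | u' != u) rate u')) -
    expR (- (k.+1%:R * e * rate u + k.+2%:R * e * \sum_(u' | u' != u) rate u')))
  <= fine (P (sampled u)).
Proof.
move=> e0.
pose A (a b : nat) := \bigcap_(u' in [set: 'I_n])
  late u' (if u' == u then a%:R * e else b%:R * e).
have mA a b : measurable (A a b).
  apply: fin_bigcap_measurable => [|u' _]; first exact: finite_finset.
  exact: (measurable_late hX v Delta hH hY).
have PA a b : P (A a b) =
    (expR (- (a%:R * e * rate u + b%:R * e * \sum_(u' | u' != u) rate u')))%:E.
  rewrite prob_all_late => [|u']; last by case: ifP => _; rewrite mulr_ge0// ltW.
  congr (expR (- _))%:E; rewrite (bigD1 u)//= eqxx; congr (_ + _).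
  by rewrite mulr_sumr; apply: eq_bigr => u' /negbTE ->.
have Asub a b : A a.+1 b `<=` A a b.
  move=> w h u' _; have := h u' I; case: ifP => // _; apply: late_anti.
    by rewrite mulr_ge0// ltW.
  by rewrite ler_wpM2r ?ler_nat// ltW.
pose B k := A k k.+2 `\` A k.+1 k.+2.
have mB k : measurable (B k) by apply: measurableD; exact: mA.
have PB k : P (B k) = (expR (- (k%:R * e * rate u + k.+2%:R * e * \sum_(u' | u' != u) rate u')) -
    expR (- (k.+1%:R * e * rate u + k.+2%:R * e * \sum_(u' | u' != u) rate u')))%:E.
  rewrite measureD//; last by rewrite ltey_eq fin_num_measure.
  by rewrite (setIidr (@Asub _ _)) EFinB; congr (_ - _)%E; exact: PA.
have BP k w : B k w -> late u (k%:R * e) w /\ ~ late u (k.+1%:R * e) w.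
  move=> [h1 h2]; split; first by have := h1 u I; rewrite eqxx.
  move=> h3; apply: h2 => u' _; case: eqP => [->//|/eqP /negbTE u'u].
  by have := h1 u' I; rewrite u'u.
have Bsub k : B k `<=` sampled u.
  move=> w Bw; have [h1 h2] := BP _ _ Bw.
  apply: (@late_sub_sampled u (k%:R * e) (k.+1%:R * e) (k.+2%:R * e)) h1 h2 _.
  - by rewrite mulr_ge0// ltW.
  - by rewrite ler_wpM2r ?ler_nat// ltW.
  - by rewrite ltr_pM2r// ltr_nat.
  - by move=> u' /negbTE u'u; case: Bw => /(_ u' I); rewrite u'u.
(* For [j < k], lateness of [u] at [k e] implies lateness at [(j + 1) e], which [B j] excludes. *)
have tB : trivIset setT B.
  apply: ltn_trivIset => k j jk; apply/seteqP; split=> w //= -[/BP[_ h] /BP[h' _]].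
  apply: h; apply: late_anti h'; first by rewrite mulr_ge0// ltW.
  by rewrite ler_wpM2r ?ler_nat// ltW.
rewrite -lee_fin fineK; last by apply: fin_num_measure; exact: measurable_sampled.
rewrite -sumEFin; under eq_bigr do rewrite -PB.
have mU : measurable (\big[setU/set0]_(k < N) B k) by exact: bigsetU_measurable.
rewrite -(measure_bigsetU_ord P xpredT (F := fun k : 'I_N => B k))//; last first.
  by move=> a b _ _ /(tB _ _ I I)/val_inj.
apply: le_measure; rewrite ?inE//; first exact: measurable_sampled.
by move=> w; rewrite -bigcup_mkord => -[k _]; exact: Bsub.
Qed.

Lemma rate_le_sampled u : 0 < \sum_u' rate u' ->
  rate u <= (\sum_u' rate u') * fine (P (sampled u)).
Proof.
rewrite (bigD1 u)//= => S0.
have L0 : 0 <= \sum_(u' | u' != u) rate u' by apply: sumr_ge0 => u' _; exact: rate_ge0.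
apply: (ler_of_geometric_bounds (rate_ge0 u) S0) => e N e0.
by apply: geometric_lower_bound => //; [exact: rate_ge0|exact: sampled_ge].
Qed.

Lemma sum_sampled_le1 : \sum_u fine (P (sampled u)) <= 1.
Proof.
rewrite -lee_fin -sumEFin.
rewrite (eq_bigr (fun u => P (sampled u))); last first.
  by move=> u _; rewrite fineK//; apply: fin_num_measure; exact: measurable_sampled.
rewrite -(measure_bigsetU_ord P xpredT (F := sampled))//.
- by apply: probability_le1; apply: bigsetU_measurable => u _; exact: measurable_sampled.
- by move=> u; exact: measurable_sampled.
- by move=> a b _ _ [w []]; rewrite /sampled/= => -> [].
Qed.

Lemma prob_sampled u : 0 < \sum_u' rate u' ->
  P (sampled u) = (rate u / \sum_u' rate u')%:E.
Proof.
move=> S0; set S := \sum_u' rate u'.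
have h0 u' : 0 <= S * fine (P (sampled u')) - rate u'.
  by rewrite subr_ge0 rate_le_sampled.
(* Non-negative deficits whose total is at most [S - S = 0] must all vanish. *)
have : \sum_u' (S * fine (P (sampled u')) - rate u') = 0.
  apply/eqP; rewrite eq_le sumr_ge0// andbT sumrB -mulr_sumr -/S.
  by rewrite subr_le0 ler_piMr ?(ltW S0)// sum_sampled_le1.
move/psumr_eq0P => /(_ (fun i _ => h0 i) u isT)/subr0_eq hu.
rewrite -[LHS]fineK; last by apply: fin_num_measure; exact: measurable_sampled.
by congr (_%:E); rewrite -hu mulrAC divff ?mul1r// gt_eqF.
Qed.

End sampler_lower_bound.

(** As [m] is arbitrary, this covers every moment of the stream. Summed over [u] the probabilities
    give 1, so failure has probability zero. *)
Theorem mainTheorem2 (R : realType) (G : R -> R) (hG : in_class_G G)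
  (d1 : measure_display) (W1 : measurableType d1) (PX : probability W1 R)
  (X : R -> W1 -> \bar R) (hX : levy_process_of G PX X)
  (n m : nat) (v : 'I_m -> 'I_n) (Delta : 'I_m -> R)
  (hDelta : forall i, 0 < Delta i)
  (d2 : measure_display) (W : measurableType d2) (P : probability W R)
  (H : 'I_n -> W -> R) (Y : 'I_m -> W -> R)
  (hH : forall u, uniform01_rv P (H u))
  (hY : forall i, exp1_rv P (Y i))
  (hind : mutually_independent P
            (fun j : 'I_n + 'I_m =>
               match j with inl u => H u | inr i => Y i end))
  (x : 'I_n -> R) (hx : forall u, x u = \sum_(i < m | v i == u) Delta i)
  (hpos : 0 < \sum_(u < n) G (x u)) :
  forall u : 'I_n,
    P [set w | (ds_run [seq (v i, levy_level PX X (Y i w / Delta i) (H (v i) w))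
                       | i <- enum 'I_m]).1 = Some u]
    = (G (x u) / \sum_(u' < n) G (x u'))%:E.
Proof.
have eS : \sum_(u < n) G (x u) = \sum_(u < n) G (\sum_(i | v i == u) Delta i).
  by apply: eq_bigr => u _; rewrite hx.
move=> u; rewrite eS hx.
by apply: (prob_sampled hX hDelta hH hY hind); rewrite -eS.
Qed.
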